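(* Let $m$ be a positive integer and let $\Gamma=\mathrm{Cay}(\mathbb{Z}_{2m},S)$ be a circulant graph. Then $\Gamma$ is unstable if any of the following conditions holds: (i) there exist a subgroup $K$ of $\mathbb{Z}_{2m}$ of even order and a nontrivial subgroup $H$ of $K$ of odd order such that $(S\setminus K_o)+H=S\setminus K_o$, where $K_o=K\setminus 2K$; (ii) $\Gamma\cong\mathrm{Cay}(\mathbb{Z}_{2m},S+m)$; (iii) $\mathrm{Cay}\big(\mathbb{Z}_{2m},(S\setminus\{m\})+m\big)$ has an automorphism fixing $0$ but moving $m$.
   Context: For an additive group $G$ and an inverse-closed subset $S\subseteq G\setminus\{0\}$, the Cayley graph $\mathrm{Cay}(G,S)$ has vertex set $G$, with $x\sim y$ iff $y-x\in S$. For subsets $A,B$ of $G$ and $g\in G$, $A+B=\{a+b:a\in A,b\in B\}$, $A+g=\{a+g:a\in A\}$, and $2K=\{2k:k\in K\}$. A graph $\Lambda$ is stable if $\mathrm{Aut}(\Lambda\times K_2)=\mathrm{Aut}(\Lambda)\times\mathrm{Aut}(K_2)$, where $\Lambda\times K_2$ is the direct product (vertex set $V(\Lambda)\times V(K_2)$, $(a,x)\sim(b,y)$ iff $a\sim b$ and $x\sim y$) on which $\mathrm{Aut}(\Lambda)\times\mathrm{Aut}(K_2)$ acts coordinatewise; otherwise $\Lambda$ is unstable. *)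

(* Defs.v *)
From HB Require Import structures.
From mathcomp Require Import all_boot all_algebra all_fingroup.

Set Implicit Arguments.
Unset Strict Implicit.
Unset Printing Implicit Defensive.

Import GRing.Theory.
Local Open Scope ring_scope.

Section Graphs.
Variables T U : finType.

(* Graphs are arbitrary adjacency relations, and isomorphisms preserve
   adjacency of every pair x, y, including x = y; so loops, if any, are
   preserved. *)
Definition graph_aut (e : rel T) : {set {perm T}} :=
  [set p : {perm T} | [forall x, forall y, e (p x) (p y) == e x y]].

Definition graph_iso (e : rel T) (e' : rel U) : Prop :=
  exists2 f : T -> U, bijective f & forall x y, e' (f x) (f y) = e x y.

Definition direct_product (e : rel T) (e' : rel U) : rel (T * U) :=
  fun u v => e u.1 v.1 && e' u.2 v.2.

Definition prod_fun (p : {perm T}) (q : {perm U}) (u : T * U) : T * U :=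
  (p u.1, q u.2).

Lemma prod_fun_inj p q : injective (prod_fun p q).
Proof. by move=> [a b] [c d] [/perm_inj-> /perm_inj->]. Qed.

Definition prod_perm (p : {perm T}) (q : {perm U}) : {perm (T * U)} :=
  perm (@prod_fun_inj p q).

End Graphs.

Definition complete_graph (n : nat) : rel 'I_n := fun i j => i != j.

(* Aut(L) x Aut(K_2) is taken as a set of permutations of V(L) x V(K_2),
   acting coordinatewise. *)
Definition stable (T : finType) (e : rel T) : Prop :=
  graph_aut (direct_product e (@complete_graph 2)) =
  [set prod_perm p q | p in graph_aut e, q in graph_aut (@complete_graph 2)].

Definition unstable (T : finType) (e : rel T) : Prop := ~ stable e.

Section Additive.
Variable G : finZmodType.
Implicit Types A B K S : {set G}.

(* No condition is put on S here: if 0 \in S, every vertex has a loop. *)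
Definition cay S : rel G := fun x y => y - x \in S.

(* A {group 'Z_n} is an additive subgroup (its law is +, and 1%g is 0), so it can
   be used directly as A, B or K below; (A * B)%g would be the same as sumset. *)
Definition sumset A B : {set G} := [set a + b | a in A, b in B].

Definition translate A (g : G) : {set G} := [set a + g | a in A].

Definition dblset K : {set G} := [set k *+ 2 | k in K].

End Additive.

(* Main.v *)
(* A pair of permutations (f, g) with f x ~ g y iff x ~ y acts on the two layers
   of the product with K_2, and it is not coordinatewise as soon as f <> g.
   In case (ii) take an isomorphism f and g = f + m.  In case (iii) take
   f = p and g y = p (y + m) + m.  In case (i) take a nonzero h in H, and let f
   translate 2K by h and g translate K_o by h: an edge with difference in K_o
   meets both of these sets or neither, and every other edge has its difference
   changed by an element of H. *)
Require Import Defs.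
From HB Require Import structures.
From mathcomp Require Import all_boot all_algebra all_fingroup.
From mathcomp Require Import cyclic zify.

Set Implicit Arguments.
Unset Strict Implicit.
Unset Printing Implicit Defensive.

Import GRing.Theory.
Local Open Scope ring_scope.

Lemma unstable_two_fold (T : finType) (e : rel T) (f g : T -> T) (a : T) :
    symmetric e -> injective f -> injective g ->
    (forall x y, e (f x) (g y) = e x y) -> f a != g a ->
  unstable e.
Proof.
move=> e_sym f_inj g_inj fgE fg_neq e_stable.
pose F (u : T * 'I_2) := (if u.2 == ord0 then f u.1 else g u.1, u.2).
have F_inj : injective F.
  move=> [x i] [y j]; rewrite /F /= => -[+ eq_ij]; rewrite -eq_ij.
  by case: ifP => _ => [/f_inj|/g_inj] ->.
have : perm F_inj \in graph_aut (Defs.direct_product e (@complete_graph 2)).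
  rewrite inE; apply/forallP=> -[x i]; apply/forallP=> -[y j].
  rewrite !permE /F /Defs.direct_product /complete_graph /=; apply/eqP.
  have [-> | /negPf neq_ij] := eqVneq i j; first by rewrite !andbF.
  rewrite !andbT; case: ifP => i0; case: ifP => j0.
  - by move: neq_ij; rewrite (eqP i0) (eqP j0) eqxx.
  - exact: fgE.
  (* The hypothesis on [f] and [g] covers edges from layer [ord0] to the other layer; the reverse
     direction follows by symmetry. *)
  - by rewrite e_sym fgE e_sym.
  - by case: i j i0 j0 neq_ij => [[|[|?]] ?] [[|[|?]] ?].
(* First coordinates over [a] in the two layers force both [f a] and [g a] to be [p a]. *)
rewrite e_stable => /imset2P[p q _ _ Fpq].
have fE : f a = p a by have /permP/(_ (a, ord0)) := Fpq; rewrite !permE => -[].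
have gE : g a = p a by have /permP/(_ (a, ord_max)) := Fpq; rewrite !permE => -[].
by rewrite fE gE eqxx in fg_neq.
Qed.

Lemma cay_sym (G : finZmodType) (S : {set G}) :
  (forall x, x \in S -> - x \in S) -> symmetric (cay S).
Proof.
move=> S_sym x y; rewrite /cay -[y - x]opprB.
by apply/idP/idP => [/S_sym | /S_sym]; rewrite ?opprK.
Qed.

Lemma in_translate (G : finZmodType) (A : {set G}) (g x : G) :
  (x \in translate A g) = (x - g \in A).
Proof.
apply/imsetP/idP => [[y yA ->] | xA]; first by rewrite addrK.
by exists (x - g); rewrite ?subrK.
Qed.

Lemma sumset_stable_addr (n : nat) (A : {set 'Z_n}) (H : {group 'Z_n}) x h :
  sumset A H = A -> h \in H -> (x + h \in A) = (x \in A).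
Proof.
move=> AH hH; apply/idP/idP => xA; rewrite -AH; apply/imset2P.
  by exists (x + h) (- h); rewrite ?addrK // (groupVr hH).
by exists x h.
Qed.

Section Doubling.
Variables (n : nat) (K : {group 'Z_n}).

Lemma dblset_sub : dblset K \subset K.
Proof. by apply/subsetP=> _ /imsetP[k kK ->]; exact: groupM. Qed.

Lemma dblsetB : {in dblset K &, forall x y, x - y \in dblset K}.
Proof.
move=> _ _ /imsetP[x xK ->] /imsetP[y yK ->]; rewrite -mulrnBl.
by apply: imset_f; apply: groupM; rewrite // groupV.
Qed.

Lemma dblsetDr x y : y \in dblset K -> (x + y \in dblset K) = (x \in dblset K).
Proof.
move=> yK; apply/idP/idP => xK; first by rewrite -[x](addrK y) dblsetB.
rewrite -[y]opprK; apply: dblsetB => //.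
by rewrite -sub0r dblsetB // -(subrr y) dblsetB.
Qed.

(** Since [#|H|] kills [h] and is odd, [h] is the double of its multiple by [(#|H| + 1) / 2]. *)
Lemma odd_order_sub_dblset (H : {group 'Z_n}) :
  H \subset K -> odd #|H| -> H \subset dblset K.
Proof.
move=> sHK oddH; apply/subsetP=> h hH; apply/imsetP.
exists (h *+ #|H|.+1./2).
  by rewrite -FinRing.zmodXgE groupX // (subsetP sHK).
rewrite -mulrnA muln2 halfK /= oddH subn0 mulrS -FinRing.zmodXgE.
by rewrite (expg_cardG hH) addr0.
Qed.

(* Since K is cyclic, 2K has index at most 2 in K. *)
Lemma dblset_odd_coset :
  {in K :\: dblset K &, forall x y, x - y \in dblset K}.
Proof.
have /cyclicP[k KE] : cyclic K.
  apply: cyclicS (subsetT K) _; apply/cyclicP; exists Zp1.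
  exact: (Zp_cycle (Zp_trunc n).+1).
have even_dbl i : ~~ odd i -> k *+ i \in dblset K.
  move=> /even_halfK <-; rewrite -muln2 mulrnA; apply: imset_f.
  by rewrite KE -FinRing.zmodXgE mem_cycle.
(* With [k] a generator of [K], elements outside [2K] are odd multiples of [k], so their differences
   are even multiples. *)
have oddP x : x \in K :\: dblset K -> exists i, x = k *+ i.*2.+1.
  rewrite inE {2}KE => /andP[xN /cycleP[i xE]]; exists i./2.
  rewrite xE FinRing.zmodXgE -[in LHS](odd_double_half i).
  by case: (boolP (odd i)) xN => //; rewrite xE FinRing.zmodXgE => /even_dbl ->.
move=> x y /oddP[i ->] /oddP[j ->]; rewrite !mulrS opprD addrACA subrr add0r.
by apply: dblsetB; rewrite even_dbl ?odd_double.
Qed.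

(** This is why the two shifts of case (i) respect edges with difference in [K_o]: either both ends
    move by [h] or neither does. *)
Lemma dblset_odd_cosetE x y :
  y - x \in K :\: dblset K -> (x \in dblset K) = (y \in K :\: dblset K).
Proof.
move=> yxKo; apply/idP/idP => [xK | yKo].
  have -> : y = y - x + x by rewrite subrK.
  move: yxKo; rewrite !in_setD (dblsetDr _ xK) => /andP[-> yxK].
  exact: groupM yxK (subsetP dblset_sub x xK).
by rewrite -[x](subKr y) dblset_odd_coset.
Qed.

End Doubling.

Theorem theorem1p5 (m : nat) (m_gt0 : (0 < m)%N) (S : {set 'Z_(2 * m)})
    (S_no0 : 0 \notin S) (S_sym : forall x, x \in S -> - x \in S) :
  [\/ exists K H : {group 'Z_(2 * m)},
        [/\ ~~ odd #|K|, H \subset K, H :!=: 1%g, odd #|H| &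
            let Ko := K :\: dblset K in
            sumset (S :\: Ko) H = S :\: Ko],
      graph_iso (cay S) (cay (translate S m%:R))
    | exists2 p : {perm 'Z_(2 * m)},
        p \in graph_aut (cay (translate (S :\ m%:R) m%:R)) &
        p 0 = 0 /\ p m%:R <> m%:R] ->
  unstable (cay S).
Proof.
have cayS_sym := cay_sym S_sym.
(* The type ['Z_n] is the integers modulo [n] only when [n > 1]. *)
have n_gt1 : (1 < 2 * m)%N by lia.
have mDm : m%:R + m%:R = 0 :> 'Z_(2 * m).
  by rewrite -natrD addnn -mul2n pchar_Zp.
have mN : - m%:R = m%:R :> 'Z_(2 * m) by apply/esym/eqP; rewrite -addr_eq0 mDm.
have m_neq0 : m%:R != 0 :> 'Z_(2 * m).
  by rewrite -val_eqE /= val_Zp_nat // modn_small; lia.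
case=> [[K [H [_ sHK ntH oddH]]] /= SH | [f f_bij fE] | [p p_aut [p0 pm]]].
- have /trivgPn[h hH h_neq0] := ntH.
  have hK : h \in dblset K by apply: subsetP hH; exact: odd_order_sub_dblset.
  have hNK : - h \in dblset K.
    by rewrite -sub0r dblsetB // -(subrr h) dblsetB.
  set Ko := K :\: dblset K in SH *.
  have KoD x y : y \in dblset K -> (x + y \in Ko) = (x \in Ko).
    move=> yK; rewrite !inE dblsetDr //.
    by rewrite (groupMr x (subsetP (dblset_sub K) y yK)).
  (* Outside [Ko], [S] agrees with [S :\: Ko], a union of cosets of [H]; adding an element of [2K]
     does not lead into [Ko]. *)
  have SHD x y : x \notin Ko -> y \in dblset K -> y \in H -> (x + y \in S) = (x \in S).
    move=> xN yK yH; have := sumset_stable_addr x SH yH.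
    by rewrite !(in_setD S Ko) KoD // xN.
  (* Translation by [h] preserves [A], hence also its complement, so the two branches have disjoint
     images. *)
  have shift_inj (A : {set 'Z_(2 * m)}) :
      (forall x, (x + h \in A) = (x \in A)) ->
      injective (fun x => if x \in A then x + h else x).
    move=> AD x y /=; case: ifP => xA; case: ifP => yA.
    + exact: addIr.
    + by move=> xy; rewrite -xy AD xA in yA.
    + by move=> xy; rewrite xy AD yA in xA.
    + by [].
  apply: (@unstable_two_fold _ _ (fun x => if x \in dblset K then x + h else x)
    (fun x => if x \in Ko then x + h else x) 0) => //.
  + by apply: shift_inj => x; exact: dblsetDr.
  + by apply: shift_inj => x; exact: KoD.
  + move=> x y; rewrite /cay; have [yxKo | yxN] := boolP (y - x \in Ko).
      rewrite (dblset_odd_cosetE yxKo) -/Ko; case: ifP => // _.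
      by rewrite opprD addrACA subrr addr0.
    case: ifP => _; case: ifP => _ //.
    * by rewrite opprD addrACA subrr addr0.
    * by rewrite addrAC SHD.
    * by rewrite opprD addrA SHD // (groupVr hH).
  (* The maps differ at [0], which lies in [2K] and not in [Ko]: they send it to [h] and to [0]. *)
  + have K0 : 0 \in dblset K by rewrite -(subrr h) dblsetB.
    by rewrite in_setD K0 add0r.
- have f_inj := bij_inj f_bij.
  apply: (@unstable_two_fold _ _ f (fun y => f y + m%:R) 0) => //.
  + by move=> x y /addIr /f_inj.
  + by move=> x y; rewrite -(fE x y) /cay in_translate mN addrAC.
  + by rewrite eq_sym -subr_eq0 addrAC subrr add0r.
- move: p_aut; rewrite inE => /forallP p_aut.
  have pE x y : (p y - p x + m%:R \in S :\ m%:R) = (y - x + m%:R \in S :\ m%:R).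
    have /forallP/(_ y)/eqP := p_aut x.
    by rewrite /cay !in_translate mN.
  apply: (@unstable_two_fold _ _ p (fun y => p (y + m%:R) + m%:R) m%:R) => //.
  + exact: perm_inj.
  + by move=> x y /addIr /perm_inj /addIr.
  + move=> x y; rewrite /cay addrAC.
    have := pE x (y + m%:R).
    have -> : y + m%:R - x + m%:R = y - x by rewrite addrAC -(addrA y) mDm addr0.
    rewrite !in_setD1.
    (* Both equations say [y + m = x], the left one by injectivity of [p]. So only the difference
       [m], which was removed from [S], is left to check. *)
    have -> : (p (y + m%:R) - p x + m%:R == m%:R) = (y - x == m%:R).
      rewrite -subr_eq0 addrK subr_eq0 (inj_eq perm_inj) -subr_eq0.
      by rewrite addrAC -[X in _ + X]mN subr_eq0.
    have [yxE _ | //] := eqVneq (y - x) m%:R.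
    have -> : y + m%:R = x.
      by apply/eqP; rewrite -subr_eq0 addrAC yxE mDm.
    (* Here both differences equal [m]. *)
    by rewrite subrr add0r yxE.
  (* At the base point [m] the second map gives [p 0 + m = m], while the first gives [p m]. *)
  + by rewrite mDm p0 add0r; apply/eqP.
Qed.
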